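(* Let $n\ge1$ and let $G$ be a Queen-Bee network with $n$ non-root vertices and average degree $\alpha$. Then the average resistance to the root satisfies $B(G)\ge \frac{5-\alpha}{3}$. Moreover, for $\alpha\in[2,3]$ this is attainable: for every $n\ge 1$ and every $\alpha\in[2,3]$ such that $\alpha n/2$ is an integer, there is a Queen-Bee network with $n$ non-root vertices and average degree $\alpha$ for which $B(G)=\frac{5-\alpha}{3}$.
   Context: A graph means a finite graph, possibly with multiple (parallel) edges; each edge is a unit resistor, and $R_{xy}$ denotes effective resistance ($R_{xx}=0$). A rooted graph is a graph with a designated root vertex $\rho$. A Queen-Bee network is a rooted graph in which every non-root vertex is joined to the root by at least one edge (multiple edges are allowed). For a rooted graph with $n$ non-root vertices, $B(G)=\frac1n\sum_{x\in V(G)}R_{\rho x}$, and its average degree is $\alpha=2e(G)/n$, where $e(G)$ is the number of edges. *)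

(* Defs.v *)
From HB Require Import structures.
From mathcomp Require Import all_boot all_order all_algebra.
From mathcomp Require Import boolp classical_sets reals.

Set Implicit Arguments.
Unset Strict Implicit.
Unset Printing Implicit Defensive.

Import Order.TTheory GRing.Theory Num.Theory.

Local Open Scope ring_scope.

(* Loops are excluded; distinct edges may have the same pair of endpoints. *)
Record multigraph := Multigraph {
  vertex : finType;
  edge : finType;
  ends : edge -> {set vertex};
  card_ends : forall e : edge, #|ends e| = 2%N }.

Record rooted_graph := RootedGraph {
  graph :> multigraph;
  root : vertex graph }.

Definition nb_edges (G : multigraph) : nat := #|edge G|.

Definition nb_nonroot (G : rooted_graph) : nat :=
  #|[set x : vertex G | x != root G]|.

Definition queen_bee (G : rooted_graph) : Prop :=
  forall x : vertex G, x != root G ->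
    exists e : edge G, ends e = [set root G; x].

(* Net current leaving [x] (Ohm's law) when each edge is a unit resistor and *)
(* the vertices are held at the potentials [v].  Each edge at [x] contributes *)
(* the potential drop towards its other endpoint; the term [y = x] is 0. *)
Definition net_current (R : realType) (G : multigraph) (v : vertex G -> R)
    (x : vertex G) : R :=
  \sum_(e : edge G | x \in ends e) \sum_(y in ends e) (v x - v y).

(* Kirchhoff's node law for a unit current entering at [s], leaving at [t]. *)
Definition unit_current_potential (R : realType) (G : multigraph)
    (s t : vertex G) (v : vertex G -> R) : Prop :=
  forall x : vertex G, net_current v x = (x == s)%:R - (x == t)%:R.

(* Potential difference between [s] and [t] under a unit current from [s] to *)
(* [t].  All such potentials give the same difference, and one exists iff [s] *)
(* and [t] are connected; the default value 0 is used only otherwise. *)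
Definition eff_res (R : realType) (G : multigraph) (s t : vertex G) : R :=
  xget 0 [set r : R | exists2 v : vertex G -> R,
    unit_current_potential s t v & r = v s - v t]%classic.

Definition avg_resistance (R : realType) (G : rooted_graph) : R :=
  (nb_nonroot G)%:R^-1 * \sum_(x : vertex G) eff_res R (root G) x.

Definition avg_degree (R : realType) (G : rooted_graph) : R :=
  2 * (nb_edges G)%:R / (nb_nonroot G)%:R.

(* Main.v *)
(* Ground the root.  The grounded Laplacian is L = 1 + sum_e w_e w_e^T, where   *)
(* the identity comes from one chosen spoke per non-root vertex, the sum is     *)
(* over the m other edges, and w_e is the signed incidence vector of e with its *)
(* root entry erased, so |w_e|^2 <= 2.  The resistances to the root are the     *)
(* diagonal entries of P = L^-1.  By Sherman-Morrison, adding w to L lowers     *)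
(* tr P by |P w|^2 / (1 + r) with r = <w, P w>; since L >= 1, |P w|^2 <= r <= 2 *)
(* and the loss is at most 2/3.  Equality holds when the extra edges form a     *)
(* matching avoiding the root, for then P = 1 - (sum_e w_e w_e^T) / 3.          *)
Require Import Defs.
From HB Require Import structures.
From mathcomp Require Import all_boot all_order all_algebra.
From mathcomp Require Import ring lra zify.
From mathcomp Require Import boolp classical_sets reals.

Import Order.TTheory GRing.Theory Num.Theory.

Local Open Scope ring_scope.

(** With [n] non-root vertices and [m] edges beyond the chosen spokes, [alpha] is 2(n + m)/n, so (5
    - alpha)/3 = 1 - 2m/(3n). The claim is thus that the star alone has total resistance n and each
    extra edge lowers it by at most 2/3. [rank_one_inverse_ex] proves this as a trace bound,
    [eff_res_inverse] reads the resistances off the diagonal of the inverse, and [sum_eff_res_ge]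
    combines the two. For sharpness, [rank_one_inverse_orthogonal] shows that orthogonal extra edges
    lose exactly 2/3 each; [matched_star] realises this with any m up to n/2, which is [alpha] from
    2 to 3. *)

Section RankOneUpdates.
Context {F : realFieldType} {T : finType} {I : eqType}.
Implicit Types (u v : T -> F) (w : I -> T -> F) (r : seq I) (P : T -> T -> F).

(** * Rank-one perturbations of the identity and the trace of their inverse *)

Definition dot u v : F := \sum_x u x * v x.

Lemma dotC u v : dot u v = dot v u.
Proof. by apply: eq_bigr => x _; rewrite mulrC. Qed.

Lemma eq_dotr u v v' : v =1 v' -> dot u v = dot u v'.
Proof. by move=> e; apply: eq_bigr => x _; rewrite e. Qed.

Lemma dotBr u v v' : dot u (fun x => v x - v' x) = dot u v - dot u v'.
Proof. by rewrite -sumrB; apply: eq_bigr => x _; rewrite mulrBr. Qed.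

Lemma dotZr u v c : dot u (fun x => c * v x) = c * dot u v.
Proof. by rewrite big_distrr; apply: eq_bigr => x _; rewrite mulrCA. Qed.

Lemma dot_ge0 u : 0 <= dot u u.
Proof. by apply: sumr_ge0 => x _; rewrite -expr2 sqr_ge0. Qed.

Lemma dot_eq0 u : dot u u = 0 -> u =1 fun=> 0.
Proof.
move=> /psumr_eq0P h x; apply/eqP; rewrite -sqrf_eq0 expr2; apply/eqP.
by apply: h => // y _; rewrite -expr2 sqr_ge0.
Qed.

Lemma dot_delta u z : dot u (fun x => (x == z)%:R) = u z.
Proof.
rewrite /dot (bigD1 z) //= eqxx mulr1 big1 ?addr0 // => x /negPf ->.
by rewrite mulr0.
Qed.

Definition rank_one_op w r u x : F := u x + \sum_(e <- r) w e x * dot (w e) u.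

Lemma rank_one_opB w r u v x :
  rank_one_op w r (fun y => u y - v y) x = rank_one_op w r u x - rank_one_op w r v x.
Proof.
rewrite /rank_one_op [in LHS](eq_bigr (fun e => w e x * dot (w e) u - w e x * dot (w e) v)).
  by rewrite sumrB; ring.
by move=> e _; rewrite dotBr mulrBr.
Qed.

Lemma rank_one_opZ w r c u x :
  rank_one_op w r (fun y => c * u y) x = c * rank_one_op w r u x.
Proof.
rewrite /rank_one_op mulrDr big_distrr /=; congr (_ + _); apply: eq_bigr => e _.
by rewrite dotZr mulrCA.
Qed.

Lemma dot_rank_one_op w r u :
  dot u (rank_one_op w r u) = dot u u + \sum_(e <- r) dot (w e) u ^+ 2.
Proof.
rewrite /dot /rank_one_op (eq_bigr (fun x => u x * u x +
  \sum_(e <- r) (w e x * u x) * dot (w e) u)); last first.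
  move=> x _; rewrite mulrDr big_distrr /=; congr (_ + _).
  by apply: eq_bigr => e _; rewrite mulrCA mulrA.
rewrite big_split exchange_big /=; congr (_ + _); apply: eq_bigr => e _.
by rewrite -big_distrl expr2.
Qed.

(** The rank-one terms add squares to the quadratic form, so L >= 1. Both injectivity of L and the
    bound on each trace loss rest on this. *)
Lemma dot_rank_one_op_ge w r u : dot u u <= dot u (rank_one_op w r u).
Proof.
by rewrite dot_rank_one_op lerDl; apply: sumr_ge0 => e _; rewrite sqr_ge0.
Qed.

Lemma rank_one_op_inj w r u v :
  rank_one_op w r u =1 rank_one_op w r v -> u =1 v.
Proof.
move=> huv x; apply/eqP; rewrite -subr_eq0; apply/eqP.
apply: (@dot_eq0 (fun y => u y - v y)); apply/eqP; rewrite eq_le dot_ge0 andbT.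
apply: (le_trans (dot_rank_one_op_ge w r _)).
by rewrite /dot big1 // => y _; rewrite rank_one_opB huv subrr mulr0.
Qed.

Definition rank_one_inverse w r P :=
  forall x z, rank_one_op w r (P^~ z) x = (x == z)%:R.

(** Induction on [r], one Sherman-Morrison update per vector. Symmetry of [P] is carried along
    because the update needs the row combination w^T P to coincide with P w. *)
Lemma rank_one_inverse_ex w r :
  (forall e, dot (w e) (w e) <= 2) ->
  exists P, [/\ forall x z, P x z = P z x, rank_one_inverse w r P
    & #|T|%:R - 2 / 3 * (size r)%:R <= \sum_x P x x].
Proof.
move=> w2; elim: r => [|e r [P [Psym Pinv Ptr]]].
  exists (fun x z => (x == z)%:R); split=> [x z|x z|].
  - by rewrite eq_sym.
  - by rewrite /rank_one_op big_nil addr0.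
  - by rewrite mulr0 subr0 (eq_bigr (fun=> 1)) ?sumr_const // => x _; rewrite eqxx.
pose g z := dot (w e) (P^~ z); pose c := dot (w e) g.
(* L g = w: by symmetry [g] is P w, and L P = 1. *)
have opg x : rank_one_op w r g x = w e x.
  rewrite /rank_one_op.
  have dg v : dot v g = \sum_y w e y * dot v (P^~ y).
    rewrite /dot /g /dot (eq_bigr (fun x => \sum_y v x * (w e y * P x y))).
      rewrite exchange_big; apply: eq_bigr => y _; rewrite big_distrr.
      by apply: eq_bigr => z _; rewrite mulrCA.
    by move=> z _; rewrite big_distrr; apply: eq_bigr => y _ /=; rewrite (Psym y).
  rewrite (eq_bigr (fun i => \sum_y w e y * (w i x * dot (w i) (P^~ y)))); last first.
    by move=> i _; rewrite dg big_distrr; apply: eq_bigr => y _; rewrite mulrCA.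
  rewrite exchange_big -[g x]/(\sum_y w e y * P y x) -big_split /=.
  rewrite -[RHS](dot_delta (w e)); apply: eq_bigr => y _.
  by rewrite -big_distrr -mulrDr /= (Psym y) eq_sym -Pinv.
have gc : dot g g <= c.
  apply: (le_trans (dot_rank_one_op_ge w r g)).
  by rewrite (eq_dotr _ _ _ opg) dotC.
have c0 : 0 <= c := le_trans (dot_ge0 g) gc.
(* Expanding |g - w|^2 >= 0 gives 2c <= |g|^2 + |w|^2 <= c + 2. *)
have c2 : c <= 2.
  have := dot_ge0 (fun x => g x - w e x).
  rewrite dotBr (dotC _ g) (dotC _ (w e)) !dotBr (dotC g (w e)) -/c => h.
  by have := w2 e; lra.
have c1 : 1 + c != 0 by lra.
have dP' z : dot (w e) (fun x => P x z - g z / (1 + c) * g x) = g z / (1 + c).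
  by rewrite dotBr dotZr -/(g z) -/c; field.
exists (fun x z => P x z - g z / (1 + c) * g x); split=> [x z|x z|].
- by rewrite Psym; ring.
- rewrite /rank_one_op big_cons addrCA -/(rank_one_op w r _ x) dP'.
  by rewrite rank_one_opB rank_one_opZ opg Pinv; ring.
- rewrite sumrB [X in _ <= _ - X](eq_bigr (fun x => (1 + c)^-1 * (g x * g x))); last by move=> x _; ring.
  rewrite -big_distrr -/(dot g g) /=.
  (* The trace loss is at most c/(1 + c), which is at most 2/3 as c <= 2. *)
  have : (1 + c)^-1 * dot g g <= 2 / 3.
    by rewrite mulrC ler_pdivrMr; lra.
  by rewrite -natr1; lra.
Qed.

(** Half the sum of the w w^T is an orthogonal projection Q of trace [size r], so L = 1 + 2Q has
    inverse 1 - (2/3) Q. *)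
Lemma rank_one_inverse_orthogonal w r :
  uniq r -> {in r, forall e, dot (w e) (w e) = 2} ->
  {in r &, forall e e', e != e' -> dot (w e) (w e') = 0} ->
  exists2 P, rank_one_inverse w r P
    & \sum_x P x x = #|T|%:R - 2 / 3 * (size r)%:R.
Proof.
move=> ur w2 w0.
exists (fun x z => (x == z)%:R - 3^-1 * \sum_(e <- r) w e z * w e x).
  move=> x z; rewrite /rank_one_op.
  suff -> : \sum_(e <- r) w e x * dot (w e)
      (fun y => (y == z)%:R - 3^-1 * \sum_(e <- r) w e z * w e y) =
      3^-1 * \sum_(e <- r) w e z * w e x by rewrite subrK.
  rewrite big_distrr /= big_seq [RHS]big_seq; apply: eq_bigr => e er.
  rewrite dotBr dotZr dot_delta.
  have -> : dot (w e) (fun y => \sum_(e' <- r) w e' z * w e' y) =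
      \sum_(e' <- r) w e' z * dot (w e) (w e').
    rewrite /dot (eq_bigr (fun y => \sum_(e' <- r) w e' z * (w e y * w e' y))).
      by rewrite exchange_big; apply: eq_bigr => e' _; rewrite big_distrr.
    by move=> y _; rewrite big_distrr; apply: eq_bigr => e' _; rewrite /= mulrCA.
  rewrite (bigD1_seq e) //= w2 // big_seq_cond big1 ?addr0; first by field.
  by move=> e' /andP[e'r ne]; rewrite w0 ?mulr0 // eq_sym.
rewrite sumrB -big_distrr exchange_big /=.
rewrite (eq_bigr (fun=> 1)) ?sumr_const; last by move=> x _; rewrite eqxx.
rewrite big_seq (eq_bigr (fun=> 2)) -?big_seq; last by move=> e er; exact: w2.
by rewrite big_const_seq count_predT iter_addr_0 -mulr_natr; field.
Qed.

End RankOneUpdates.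

(** * Effective resistances from the inverse of the grounded Laplacian *)

Section GroundedLaplacian.
Context {R : realType} {G : rooted_graph}.
Implicit Types (v : vertex G -> R) (e : edge G) (x z : vertex G).

(* The picked endpoint of [e] gets the sign -1; the root entry is erased. *)
Definition incidence e x : R :=
  (x \in ends e :\ Defs.root G)%:R * (-1) ^+ ([pick y in ends e] == Some x).

Lemma dot_incidence_self e :
  dot (incidence e) (incidence e) = #|ends e :\ Defs.root G|%:R.
Proof.
rewrite /dot -sumr_const [RHS]big_mkcond; apply: eq_bigr => x _.
rewrite /incidence mulrACA -expr2 -signr_addb addbb mulr1.
by case: ifP => _ /=; rewrite (expr1n, expr0n).
Qed.

Lemma dot_incidence_disjoint e e' :
  [disjoint ends e & ends e'] -> dot (incidence e) (incidence e') = 0.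
Proof.
move=> d; rewrite /dot big1 // => x _; rewrite /incidence !inE.
have [xe|] := boolP (x \in ends e); last by rewrite andbF !mul0r.
by rewrite (disjointFr d xe) andbF mul0r mulr0.
Qed.

Lemma incidence_root e : incidence e (Defs.root G) = 0.
Proof. by rewrite /incidence !inE eqxx mul0r. Qed.

(** The two ends carry opposite signs whichever one is picked, and the product of two signs does not
    see that choice. Subtracting the root potential makes the erased root entry harmless. *)
Lemma edge_current v e z : z != Defs.root G ->
  (if z \in ends e then \sum_(y in ends e) (v z - v y) else 0) =
  incidence e z * dot (incidence e) (fun y => v y - v (Defs.root G)).
Proof.
move=> nz; case: ifP => ze; last by rewrite /incidence !inE ze andbF !mul0r.
have -> : dot (incidence e) (fun y => v y - v (Defs.root G)) =
    \sum_(y in ends e) (-1) ^+ ([pick y in ends e] == Some y) * (v y - v (Defs.root G)).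
  rewrite [RHS]big_mkcond; apply: eq_bigr => y _; rewrite /incidence !inE.
  have [->|_] := eqVneq y (Defs.root G); first by rewrite subrr !mulr0 if_same.
  by case: ifP; rewrite !(mul0r, mul1r).
rewrite /incidence !inE nz ze mul1r.
have /cards2P[a [b [ab E]]] : #|ends e| == 2 by rewrite card_ends.
have [b' zb E'] : exists2 b', z != b' & ends e = [set z; b'].
  move: ze; rewrite E !inE => /orP[]/eqP ->; first by exists b.
  by exists a; rewrite 1?eq_sym // finset.setUC.
case: pickP => [p|/(_ z)]; last by rewrite ze.
rewrite E' !inE !big_setU1 ?inE //= !big_set1.
have eqS q : (Some p == Some q) = (p == q) by [].
rewrite !eqS => /orP[]/eqP ->; rewrite eqxx ?(negPf zb) 1?eq_sym ?(negPf zb) /=.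
  by rewrite expr0 expr1; ring.
by rewrite expr0 expr1; ring.
Qed.

(** The two ends of an edge see opposite drops. Hence Kirchhoff's law at the root follows from the
    law at all other vertices. *)
Lemma sum_net_current v : \sum_x net_current v x = 0.
Proof.
rewrite /net_current (exchange_big_dep xpredT) //= big1 // => e _.
rewrite (eq_bigr (fun x => \sum_(y in ends e) v x - \sum_(y in ends e) v y)); last first.
  by move=> x _; rewrite sumrB.
by rewrite sumrB exchange_big subrr.
Qed.

Lemma eff_res_diag x : eff_res R x x = 0.
Proof. by rewrite /eff_res; case: xgetP => // r _ [v _ ->]; rewrite subrr. Qed.

Section Spokes.
Context (s : vertex G -> edge G).
Hypothesis s_ends : forall x, x != Defs.root G -> ends (s x) = [set Defs.root G; x].

Definition extra_edges : {set edge G} := ~: (s @: [set x | x != Defs.root G]).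

Lemma spoke_inj : {in [set x | x != Defs.root G] &, injective s}.
Proof.
move=> x y; rewrite !inE => nx ny sxy.
have := set22 (Defs.root G) x; rewrite -s_ends // sxy s_ends // !inE (negPf nx).
by move=> /eqP.
Qed.

Lemma card_extra_edges : (#|extra_edges| + nb_nonroot G)%N = nb_edges G.
Proof. by rewrite /nb_nonroot -(card_in_imset spoke_inj) addnC cardsC. Qed.

Local Notation grounded := (rank_one_op incidence (enum extra_edges)).

(** Among the chosen spokes only that of [z] meets [z]; its drop to the root is the identity term.
    The other edges give the rank-one terms by [edge_current]. *)
Lemma net_current_grounded v z : z != Defs.root G ->
  net_current v z = grounded (fun y => v y - v (Defs.root G)) z.
Proof.
move=> nz; rewrite /net_current big_mkcond /= (bigID (mem (s @: [set x | x != Defs.root G]))) /=.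
rewrite /rank_one_op big_enum; congr (_ + _); last first.
  by apply: eq_big => [e|e _]; rewrite ?inE // edge_current.
rewrite big_imset /=; last exact: spoke_inj.
rewrite (bigD1 z) ?inE //= s_ends // set22 big_setU1 ?inE 1?eq_sym //= big_set1.
rewrite subrr addr0 big1 ?addr0 // => x; rewrite inE => /andP[nx xz].
by rewrite s_ends // !inE (negPf nz) eq_sym (negPf xz).
Qed.

(** The root is kept as a decoupled coordinate on which the operator is the identity. *)
Lemma grounded_root u : grounded u (Defs.root G) = u (Defs.root G).
Proof.
by rewrite /rank_one_op big1 ?addr0 // => e _; rewrite incidence_root mul0r.
Qed.

Section Inverse.
Context (P : vertex G -> vertex G -> R).
Hypothesis P_inv : rank_one_inverse incidence (enum extra_edges) P.

Lemma inverse_root x : P (Defs.root G) x = (Defs.root G == x)%:R.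
Proof. by rewrite -P_inv grounded_root. Qed.

(** Minus column [x] of [P] is a unit-current potential vanishing at the root, so the drop from root
    to [x] is [P x x]. *)
Lemma eff_res_inverse x : x != Defs.root G -> eff_res R (Defs.root G) x = P x x.
Proof.
move=> nx.
have cur z : z != Defs.root G -> net_current (fun y => - P y x) z = - (z == x)%:R.
  move=> nz; rewrite net_current_grounded // inverse_root [Defs.root G == x]eq_sym (negPf nx).
  rewrite -P_inv -[RHS]mulN1r -rank_one_opZ; congr (rank_one_op _ _ _ _).
  by apply/funext => y; rewrite oppr0 subr0 mulN1r.
have pot : unit_current_potential (Defs.root G) x (fun y => - P y x).
  move=> z; have [->|nz] := eqVneq z (Defs.root G); last by rewrite cur // sub0r.
  rewrite eq_sym (negPf nx) subr0.
  have := sum_net_current (fun y => - P y x); rewrite (bigD1 (Defs.root G)) //=.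
  rewrite (eq_bigr (fun z => - (z == x)%:R)) // sumrN => /eqP.
  rewrite subr_eq0 => /eqP ->; rewrite (bigD1 x) //= eqxx big1 ?addr0 //.
  by move=> y /andP[_ /negPf ->].
rewrite /eff_res; apply: xget_unique.
  exists (fun y => - P y x) => //.
  by rewrite inverse_root eq_sym (negPf nx) oppr0 sub0r opprK.
(* Uniqueness: any other potential, grounded at the root, solves the same equation, and the operator
   is injective. *)
move=> r [v vpot ->].
have := @rank_one_op_inj _ _ _ incidence (enum extra_edges)
  (fun y => v y - v (Defs.root G)) (fun y => -1 * P y x).
move=> /(_ _ x) h; rewrite -opprB h ?mulN1r ?opprK // => z.
rewrite rank_one_opZ P_inv mulN1r.
have [->|nz] := eqVneq z (Defs.root G).
  by rewrite grounded_root subrr eq_sym (negPf nx) oppr0.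
by rewrite -net_current_grounded // vpot (negPf nz) sub0r.
Qed.

(** The decoupled root coordinate adds 1 to the trace, while the root has resistance 0 to itself. *)
Lemma sum_eff_res_inverse :
  \sum_x eff_res R (Defs.root G) x = \sum_x P x x - 1.
Proof.
rewrite (bigD1 (Defs.root G)) //= eff_res_diag [in RHS](bigD1 (Defs.root G)) //=.
rewrite inverse_root eqxx add0r addrC addrK.
by apply: eq_bigr => x /eff_res_inverse.
Qed.

End Inverse.

Lemma card_vertex_nonroot : #|vertex G| = (nb_nonroot G).+1.
Proof.
have -> : nb_nonroot G = #|[set~ Defs.root G]|.
  by apply: eq_card => x; rewrite !inE.
by rewrite -cardsT (cardsD1 (Defs.root G)) inE finset.setTD.
Qed.

Lemma sum_eff_res_ge :
  (nb_nonroot G)%:R - 2 / 3 * #|extra_edges|%:R <= \sum_x eff_res R (Defs.root G) x.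
Proof.
have [|P [_ P_inv]] := @rank_one_inverse_ex _ _ _ incidence (enum extra_edges).
  move=> e; rewrite dot_incidence_self ler_nat -(card_ends e).
  by rewrite subset_leq_card // subD1set.
rewrite (sum_eff_res_inverse _ P_inv) -cardE card_vertex_nonroot -natr1.
by lra.
Qed.

(** Avoiding the root gives squared norm exactly 2, and disjointness gives orthogonality. *)
Lemma sum_eff_res_matching :
  {in extra_edges, forall e, Defs.root G \notin ends e} ->
  {in extra_edges &, forall e e', e != e' -> [disjoint ends e & ends e']} ->
  \sum_x eff_res R (Defs.root G) x = (nb_nonroot G)%:R - 2 / 3 * #|extra_edges|%:R.
Proof.
move=> nr dj.
have [||P P_inv Ptr] := rank_one_inverse_orthogonal incidence _ (enum_uniq extra_edges).
- move=> e; rewrite mem_enum => /nr re; rewrite dot_incidence_self.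
  by have := cardsD1 (Defs.root G) (ends e); rewrite (negPf re) card_ends add0n => <-.
- move=> e e'; rewrite !mem_enum => he he' ne.
  by rewrite dot_incidence_disjoint // dj.
rewrite (sum_eff_res_inverse _ P_inv) Ptr -cardE card_vertex_nonroot -natr1.
by ring.
Qed.

End Spokes.

End GroundedLaplacian.

(** * The extremal networks: a star plus a matching on its leaves *)

Section MatchedStar.
Context (n m : nat) (mn : (m.*2 <= n.+1)%N).

(** [None] is the root; the extra edge [j] joins leaves 2j and 2j + 1, which [mn] keeps in range so
    that [inord] is faithful. *)
Definition matched_star_ends (e : 'I_n.+1 + 'I_m) : {set option 'I_n.+1} :=
  match e with
  | inl i => [set None; Some i]
  | inr j => [set Some (inord j.*2); Some (inord j.*2.+1)]
  end.

Lemma card_matched_star_ends e : #|matched_star_ends e| = 2.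
Proof.
case: e => [i|j] /=; first by rewrite cards2.
rewrite cards2.
have := ltn_ord j; move: (nat_of_ord j) => k km.
by rewrite (inj_eq (@Some_inj _)) -val_eqE /= !inordK; lia.
Qed.

Definition matched_star : rooted_graph :=
  @RootedGraph (Multigraph card_matched_star_ends) None.

Definition spoke (x : vertex matched_star) : edge matched_star := inl (odflt ord0 x).

Lemma spoke_ends x : x != Defs.root matched_star ->
  ends (spoke x) = [set Defs.root matched_star; x].
Proof. by case: x. Qed.

Lemma queen_bee_matched_star : queen_bee matched_star.
Proof. by move=> x nx; exists (spoke x); exact: spoke_ends. Qed.

Lemma nb_nonroot_matched_star : nb_nonroot matched_star = n.+1.
Proof.
by apply: succn_inj; rewrite -card_vertex_nonroot card_option card_ord.
Qed.

Lemma nb_edges_matched_star : nb_edges matched_star = (n.+1 + m)%N.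
Proof. by rewrite /nb_edges card_sum !card_ord. Qed.

Lemma extra_edges_matched_star e :
  e \in extra_edges spoke -> exists j, e = inr j.
Proof.
case: e => [i|j _]; last by exists j.
rewrite inE => /negP[]; apply/imsetP; exists (Some i) => //.
by rewrite inE.
Qed.

Lemma sum_eff_res_matched_star (R : realType) :
  \sum_x eff_res R (Defs.root matched_star) x = n.+1%:R - 2 / 3 * m%:R.
Proof.
rewrite (@sum_eff_res_matching R _ _ spoke_ends).
- have := card_extra_edges _ spoke_ends.
  rewrite nb_nonroot_matched_star nb_edges_matched_star addnC => /addnI ->.
  by [].
- by move=> e /extra_edges_matched_star[j ->]; rewrite !inE.
- move=> e e' /extra_edges_matched_star[j ->] /extra_edges_matched_star[j' ->] ne.
  have {ne} : j != j' by apply: contra ne => /eqP ->.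
  rewrite -val_eqE /= => ne; apply/pred0P => x /=; apply/negbTE.
  rewrite !inE; case: x => [x|] //; rewrite !(inj_eq (@Some_inj _)) -!val_eqE /=.
  have := ltn_ord j; have := ltn_ord j' => hj' hj.
  by rewrite !inordK; lia.
Qed.

End MatchedStar.

Theorem theorem19 (R : realType) :
  (forall (n : nat) (alpha : R) (G : rooted_graph),
      (1 <= n)%N ->
      queen_bee G -> nb_nonroot G = n -> avg_degree R G = alpha ->
      (5 - alpha) / 3 <= avg_resistance R G) /\
  (forall (n : nat) (alpha : R),
      (1 <= n)%N ->
      2 <= alpha <= 3 ->
      alpha * n%:R / 2 \is a Num.int ->
      exists G : rooted_graph,
        [/\ queen_bee G, nb_nonroot G = n, avg_degree R G = alpha
          & avg_resistance R G = (5 - alpha) / 3]).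
Proof.
split=> [n alpha G n1 qb nG <-|[//|n] alpha _ /andP[a2 a3] /intrP[k ak]].
  (* As n >= 1 there is some edge [e0], which serves as the value of the spoke function at the
     root. *)
  have [x0] : exists x, x \in [set x | x != Defs.root G].
    by apply/card_gt0P; rewrite -/(nb_nonroot G) nG.
  rewrite inE => /qb[e0 _].
  have [s s_ends] : {s : vertex G -> edge G &
      forall x, x != Defs.root G -> ends (s x) = [set Defs.root G; x]}.
    apply: (@choice _ _ (fun x e => x != Defs.root G -> ends e = _)) => x.
    have [->|/qb[e he]] := eqVneq x (Defs.root G); first by exists e0.
    by exists e.
  have := @sum_eff_res_ge R _ _ s_ends; rewrite /avg_resistance /avg_degree.
  rewrite -(card_extra_edges _ s_ends) nG natrD; move: (\sum_x _) (#|_|%:R : R) => S M.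
  have n0 : 0 < n%:R :> R by rewrite ltr0n.
  rewrite [_^-1 * S]mulrC ler_pdivlMr // => h; apply: le_trans h.
  by rewrite le_eqVlt; apply/orP; left; apply/eqP; field; rewrite gt_eqF.
have n0 : 0 < n.+1%:R :> R by rewrite ltr0n.
have ea : alpha = 2 * k%:~R / n.+1%:R.
  by rewrite -ak; field; rewrite nat1r pnatr_eq0.
(* Here [k] is the required number of edges: [alpha] >= 2 leaves enough for all spokes, and [alpha]
   <= 3 makes the [m] remaining ones fit in a matching. *)
have kn : (n.+1%:Z <= k)%R by rewrite -(@ler_int R) -ak -pmulrn; nra.
have kn' : (k * 2 <= n.+1%:Z * 3)%R.
  by rewrite -(@ler_int R) !rmorphM /= -ak -pmulrn; nra.
have [m km] : exists m, k = (n.+1 + m)%:Z by exists `|k - n.+1%:Z|%N; lia.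
have mn : (m.*2 <= n.+1)%N by lia.
exists (matched_star _ _ mn); rewrite /avg_degree /avg_resistance.
rewrite nb_edges_matched_star sum_eff_res_matched_star nb_nonroot_matched_star.
rewrite ea km -pmulrn natrD.
split=> //; first exact: queen_bee_matched_star.
by field; rewrite nat1r pnatr_eq0.
Qed.
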